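(* For every $F\in\mathsf{For}$ and $i\ge 1$, the product $\mathfrak{P}_{\underline{i}}\,\mathfrak{P}_F=(x_i+x_{i-1}+x_{i-2}+\cdots+x_1)\,\mathfrak{P}_F$ is multiplicity-free forest positive.
   Context: $\mathbb{N}=\{1,2,\ldots\}$ and $\mathrm{Pol}=\mathbb{Z}[x_1,x_2,\ldots]$. Forests: a binary tree is a finite rooted plane tree in which each node is either a leaf (no children) or internal, having an ordered pair of children $v_L,v_R$; $\ast$ is the tree with a single node (a leaf). An indexed forest is an infinite sequence $F=(T_1,T_2,\ldots)$ of binary trees, all but finitely many equal to $\ast$; $\mathsf{For}$ is the set of indexed forests. The leaves of $F$, read from left to right, are identified with $1,2,3,\ldots$. $\mathrm{IN}(F)$ is the finite set of internal nodes. For $v\in \mathrm{IN}(F)$, $\rho_F(v)\in\mathbb{N}$ is the leaf reached from $v$ by repeatedly passing to the left child. $\underline{i}$ is the forest whose only nontrivial tree is its $i$-th tree, which has exactly one internal node. Forest polynomials: let $\mathcal{C}(F)$ be the set of $\kappa:\mathrm{IN}(F)\to\mathbb{N}$ such that for all $v\in \mathrm{IN}(F)$: $\kappa(v)\le\rho_F(v)$; if $v_L\in \mathrm{IN}(F)$ then $\kappa(v)\le\kappa(v_L)$; if $v_R\in \mathrm{IN}(F)$ then $\kappa(v)<\kappa(v_R)$. Then $\mathfrak{P}_F=\sum_{\kappa\in\mathcal{C}(F)}\prod_{v\in \mathrm{IN}(F)}x_{\kappa(v)}$. The forest polynomials form a $\mathbb{Z}$-basis of $\mathrm{Pol}$.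 A polynomial $f\in\mathrm{Pol}$ is multiplicity-free forest positive if all coefficients $a_G$ in its expansion $f=\sum_{G\in\mathsf{For}}a_G\mathfrak{P}_G$ lie in $\{0,1\}$. *)

(* Defs.v *)
From HB Require Import structures.
From mathcomp Require Import all_boot all_order all_algebra finmap.
From mathcomp Require Import monalg.
Set Implicit Arguments.
Unset Strict Implicit.
Unset Printing Implicit Defensive.
Import GRing.Theory.
Local Open Scope fset_scope.
Local Open Scope ring_scope.

(* Index convention: the positive integers 1, 2, 3, ... of the mathematical
   text are represented by 0, 1, 2, ... : nat, uniformly for the variables, the
   trees of a forest, its leaves and the values of labellings.  All conditions
   below only compare such indices with each other, so they are unaffected by
   the shift. *)

Inductive bintree := Leaf | Node of bintree & bintree.

Fixpoint bintree_encode (t : bintree) : GenTree.tree unit :=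
  if t is Node l r then GenTree.Node 0 [:: bintree_encode l; bintree_encode r]
  else GenTree.Leaf tt.

Fixpoint bintree_decode (t : GenTree.tree unit) : option bintree :=
  match t with
  | GenTree.Leaf _ => Some Leaf
  | GenTree.Node _ [:: l; r] =>
      if (bintree_decode l, bintree_decode r) is (Some l', Some r')
      then Some (Node l' r') else None
  | _ => None
  end.

Lemma bintree_encodeK : pcancel bintree_encode bintree_decode.
Proof. by elim=> //= l -> r ->. Qed.

HB.instance Definition _ := Countable.copy bintree (pcan_type bintree_encodeK).

(* A node of a tree is given by the path from the root, where [false] means
   "go left" and [true] means "go right". *)
Definition treepath := seq bool.

Fixpoint subtree (t : bintree) (p : treepath) : bintree :=
  match p, t with
  | [::], _ => t
  | b :: p', Node l r => subtree (if b then r else l) p'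
  | _ :: _, Leaf => Leaf
  end.

Fixpoint internals (t : bintree) : seq treepath :=
  if t is Node l r
  then [::] :: map (cons false) (internals l) ++ map (cons true) (internals r)
  else [::].

(* from left to right *)
Fixpoint leaves (t : bintree) : seq treepath :=
  if t is Node l r
  then map (cons false) (leaves l) ++ map (cons true) (leaves r)
  else [:: [::]].

Fixpoint leftmost (t : bintree) : treepath :=
  if t is Node l _ then false :: leftmost l else [::].

Definition forest := {fsfun nat -> bintree with Leaf}.

Definition uforest (i : nat) : forest :=
  [fsfun j in [fset i] => Node Leaf Leaf | Leaf].

(* (index of the tree, path inside that tree) *)
Definition node := (nat * treepath)%type.

Definition lchild (v : node) : node := (v.1, rcons v.2 false).
Definition rchild (v : node) : node := (v.1, rcons v.2 true).

Definition IN (F : forest) : {fset node} :=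
  [fset ((j, p) : node) | j in finsupp F, p in internals (F j)].

Definition leaf_number (F : forest) (l : node) : nat :=
  (\sum_(j < l.1) size (leaves (F j)) + index l.2 (leaves (F l.1)))%N.

Definition rho (F : forest) (v : node) : nat :=
  leaf_number F (v.1, v.2 ++ leftmost (subtree (F v.1) v.2)).

Definition compatible (F : forest) (kappa : IN F -> nat) : bool :=
  [forall v : IN F,
    [&& (kappa v <= rho F (val v))%N,
        [forall w : IN F, (val w == lchild (val v)) ==> (kappa v <= kappa w)%N]
      & [forall w : IN F, (val w == rchild (val v)) ==> (kappa v < kappa w)%N]]].

Definition Pol := {malg int[{cmonom nat}]}.

Definition x (i : nat) : Pol := << ucm i >>.

Definition rho_max (F : forest) : nat := \max_(v : IN F) rho F (val v).

(* A compatible kappa satisfies kappa v <= rho F v, so restricting the codomain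
   to {0, ..., rho_max F} loses nothing; it only makes the sum finite. *)
Definition forest_poly (F : forest) : Pol :=
  \sum_(kappa : {ffun IN F -> 'I_(rho_max F).+1} |
         compatible (F := F) (fun v => nat_of_ord (kappa v)))
    \prod_(v : IN F) x (kappa v).

Definition forest_expansion (f : Pol) (a : {fsfun forest -> int with 0}) : Prop :=
  f = \sum_(G <- finsupp a) a G *: forest_poly G.

(* Forest polynomials form a Z-basis of Pol, so the expansion [a] of [f] exists
   and is unique. *)
Definition multiplicity_free_forest_positive (f : Pol) : Prop :=
  exists2 a : {fsfun forest -> int with 0},
    forest_expansion f a & forall G : forest, a G = 0 \/ a G = 1.

(* Main.v *)
From HB Require Import structures.
Require Import Defs.
From mathcomp Require Import all_boot all_order all_algebra finmap.
From mathcomp Require Import monalg.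
From mathcomp Require Import zify ring.
Set Implicit Arguments.
Unset Strict Implicit.
Unset Printing Implicit Defensive.
Import GRing.Theory.
Local Open Scope ring_scope.

(** Indices of variables, leaves and labels start at 0.  Let [R k] be the
    substitution that puts 0 for the variable k and closes the gap, and let
    T_i f = (R_(i+1) f - R_i f) / x_i be the trimming operators.  They act on
    forest polynomials by removing nodes: T_i P_F is P_F' when the leaves i and
    i+1 of F are the two children of one node and F' arises from F by turning
    this node into a leaf, and T_i P_F = 0 otherwise
    ([T_standard_poly]).  Deleting a label from the alphabet only changes the
    bounds on the labels, so R_i P_F and R_(i+1) P_F are the same sum except
    that the bound at the leaf i is i in the first and i+1 in the second; the
    labellings in the difference are those in which a node with leftmost leaf i
    has the label i, and this forces the lowest such node to have the leaves i
    and i+1 as children ([tree_poly_diff]).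

    A word v in the operators T_i, followed by evaluation at 0, is a linear
    form.  Stripping the nodes of G one after the other gives a word whose form
    is 1 on P_G and 0 on the other forest polynomials ([dual_word]), and the
    forest polynomials span all polynomials ([span]).  So a polynomial f is
    multiplicity-free forest positive as soon as every word takes the value 0
    or 1 on f.  This property, [mfree], holds for f if it holds for every T_i f and
    f(0) is 0 or 1 ([mfreeT]), which makes an induction on the number of nodes
    possible and spares any explicit description of the forests in the product.

    The first step is [mfree (R k P_F)]: commuting T_i with R_k costs nothing,
    except that T_k R_(k+1) = R_(k+1) T_k + R_k T_(k+1).  Here at most one of
    the two terms survives, since the leaf k+1 cannot be a sibling both of k and
    of k+2 ([trim_seq_next]).  For the product with y_m = x_0 + ... + x_(m-1),
    the twisted Leibniz rule gives T_i (y_m P_F) = y_m' T_i P_F with m' = m or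
    m' = m - 1, a smaller case, unless m = i+1; then there is a second term
    R_(i+1) P_F.  If T_i P_F = 0, only R_(i+1) P_F is left.  If not, T_(i+1) P_F
    and T_(i-1) P_F vanish, and one more trimming T_k brings T_k T_i (y_m P_F)
    into the form T_l (y_m'' T_h P_F), which is again a smaller case
    ([mfree_varsum_standard_poly]). *)

(** * Trimming and grafting binary trees *)

Fixpoint nleaves (t : bintree) : nat :=
  if t is Node l r then (nleaves l + nleaves r)%N else 1.

Lemma nleaves_gt0 t : (0 < nleaves t)%N.
Proof. by elim: t => //= l hl r hr; rewrite addn_gt0 hl. Qed.

Lemma size_leaves t : size (leaves t) = nleaves t.
Proof. by elim: t => //= l hl r hr; rewrite size_cat !size_map hl hr. Qed.

(** The argument [o] is the number of the leftmost leaf of the tree, so that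
    leaves keep the number that they have in the whole forest.  The result is
    [None] if the leaves [p] and [p.+1] are not siblings. *)
Fixpoint trim (p o : nat) (t : bintree) : option bintree :=
  if t is Node l r then
    if [&& p == o, l == Leaf & r == Leaf] then Some Leaf
    else if (p < o + nleaves l)%N then omap (Node^~ r) (trim p o l)
    else omap (Node l) (trim p (o + nleaves l) r)
  else None.

Fixpoint graft (p o : nat) (t : bintree) : bintree :=
  if t is Node l r then
    if (p < o + nleaves l)%N then Node (graft p o l) r
    else Node l (graft p (o + nleaves l) r)
  else Node Leaf Leaf.

Lemma nleaves_graft p o t : nleaves (graft p o t) = (nleaves t).+1.
Proof.
elim: t o => //= l hl r hr o; case: ltnP => _ /=; first by rewrite hl.
by rewrite hr addnS.
Qed.

Lemma graft_neq_Leaf p o t : (graft p o t == Leaf) = false.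
Proof. by case: t => //= l r; case: ifP. Qed.

Lemma graftK p o t : (o <= p < o + nleaves t)%N -> trim p o (graft p o t) = Some t.
Proof.
elim: t o => /= [|l hl r hr] o h; first by rewrite (_ : p == o); [|lia].
case: ltnP => pl /=; rewrite graft_neq_Leaf ?andbF /=.
  by rewrite nleaves_graft ifT ?hl //; lia.
by rewrite ifF ?hr //; lia.
Qed.

(** Trimming is injective: the result and [p] determine the tree. *)
Lemma trimP p o t t' : (o <= p)%N -> trim p o t = Some t' ->
  t = graft p o t' /\ (p < o + nleaves t')%N.
Proof.
elim: t o t' => //= l hl r hr o t' op.
case: ifP => [/and3P[/eqP -> /eqP -> /eqP ->] [<-]|_].
  by split => //=; rewrite addn1.
case: ltnP => pl.
  case E: trim => [l'|] //= [<-] /=; case: (hl _ _ op E) => -> h.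
  by rewrite h; split => //; lia.
case E: trim => [r'|] //= [<-] /=; case: (hr _ _ pl E) => -> h.
by rewrite ltnNge pl; split => //; lia.
Qed.

(** A leaf has only one sibling. *)
Lemma trim_next p o t : (o <= p)%N -> trim p o t -> trim p.+1 o t = None.
Proof.
elim: t o => //= l hl r hr o op.
case: ifP => [/and3P[/eqP -> /eqP -> /eqP ->] _ /=|_].
  by rewrite (gtn_eqF (ltnSn o)) /=; case: ifP.
have -> : (p.+1 == o) = false by lia.
case: (ltnP p (o + nleaves l)) => pl.
  case E: (trim p o l) => [l'|] // _; case: (trimP op E) => lE pl'.
  by rewrite ifT ?hl ?E // lE nleaves_graft; lia.
case E: (trim p (o + nleaves l) r) => [r'|] // _.
by rewrite ifF ?hr ?E //; lia.
Qed.

Lemma trim_shift p o t : trim p.+1 o.+1 t = trim p o t.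
Proof. by elim: t o => //= l hl r hr o; rewrite eqSS addSn ltnS hl hr. Qed.

(** Trimming at [p] lowers the numbers of the later leaves by one and does not
    change which of them are siblings. *)
Lemma trim_trim p q o t t' : (o <= p < q)%N -> trim p o t = Some t' ->
  trim q.+1 o t -> trim q o t'.
Proof.
elim: t o t' => //= l hl r hr o t' opq.
case: ifP => [/and3P[_ /eqP -> /eqP ->] _ /=|_].
  by rewrite andbT; case: eqP => [|_]; [lia | case: ifP].
have [op pq] := andP opq; have -> : (q.+1 == o) = false by lia.
case: (ltnP p (o + nleaves l)) => pl.
  case E: (trim p o l) => [l'|] //= [<-].
  have lE : nleaves l = (nleaves l').+1 by rewrite (trimP op E).1 nleaves_graft.
  rewrite /= (_ : (q == o) = false); last lia.
  rewrite lE addnS ltnS; case: ltnP => ql.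
    move: (hl _ _ opq E); case: (trim q.+1 o l) => [l''|] //= /(_ isT).
    by case: (trim q o l').
  by rewrite trim_shift; case: (trim q _ r).
case E: (trim p _ r) => [r'|] //= [<-].
rewrite ifF; last lia.
rewrite /= (_ : (q == o) = false); last lia.
rewrite ifF; last lia.
have opq' : (o + nleaves l <= p < q)%N by rewrite pl.
move: (hr _ _ opq' E); case: (trim q.+1 _ r) => [r''|] //= /(_ isT).
by case: (trim q _ r').
Qed.

Lemma trim_exists o t : t != Leaf -> exists p, (o <= p < o + nleaves t)%N /\ trim p o t.
Proof.
elim: t o => //= l hl r hr o _; case: (eqVneq l Leaf) => [->|nl] /=.
  case: (eqVneq r Leaf) => [->|nr] /=; first by exists o; rewrite eqxx; split => //; lia.
  case: (hr (o + 1)%N nr) => p [h1 h2]; exists p; split; first lia.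
  by rewrite andbF ifF; [case: trim h2 | lia].
case: (hl o nl) => p [h1 h2]; exists p; split; first lia.
by rewrite andbF ifT; [case: trim h2 | lia].
Qed.

Fixpoint nleaves_seq (ts : seq bintree) : nat :=
  if ts is t :: ts' then (nleaves t + nleaves_seq ts')%N else 0.

(** Sequences of trees stand for forests whose remaining trees are leaves.
    Unlike finitely supported functions they allow structural recursion, and
    trimming preserves their length. *)
Fixpoint trim_seq (p o : nat) (ts : seq bintree) : option (seq bintree) :=
  if ts is t :: ts' then
    if (p < o + nleaves t)%N then omap (cons^~ ts') (trim p o t)
    else omap (cons t) (trim_seq p (o + nleaves t) ts')
  else None.

Fixpoint graft_seq (p o : nat) (ts : seq bintree) : seq bintree :=
  if ts is t :: ts' then
    if (p < o + nleaves t)%N then graft p o t :: ts'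
    else t :: graft_seq p (o + nleaves t) ts'
  else [::].

Lemma graft_seqK p o ts : (o <= p < o + nleaves_seq ts)%N ->
  trim_seq p o (graft_seq p o ts) = Some ts.
Proof.
elim: ts o => /= [|t ts IH] o h; first lia.
case: ltnP => pl /=; first by rewrite nleaves_graft ifT ?graftK //; lia.
by rewrite ifF ?IH //; lia.
Qed.

Lemma trim_seqP p o ts ts' : (o <= p)%N -> trim_seq p o ts = Some ts' ->
  ts = graft_seq p o ts'.
Proof.
elim: ts o ts' => //= t ts IH o ts' op; case: ltnP => pl.
  case E: trim => [t'|] //= [<-] /=.
  by case: (trimP op E) => -> ->.
case E: trim_seq => [us|] //= [<-] /=.
by rewrite ltnNge pl /= -(IH _ _ pl E).
Qed.

Lemma size_trim_seq p o ts ts' : trim_seq p o ts = Some ts' -> size ts' = size ts.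
Proof.
elim: ts o ts' => //= t ts IH o ts'; case: ltnP => pl.
  by case: trim => [t'|] //= [<-].
by case E: trim_seq => [us|] //= [<-] /=; rewrite (IH _ _ E).
Qed.

Lemma trim_seq_next p o ts : (o <= p)%N -> trim_seq p o ts -> trim_seq p.+1 o ts = None.
Proof.
elim: ts o => //= t ts IH o op; case: (ltnP p (o + nleaves t)) => pl.
  case E: (trim p o t) => [t'|] // _; case: (trimP op E) => tE pl'.
  by rewrite ifT ?trim_next ?E // tE nleaves_graft; lia.
case E: trim_seq => [us|] // _.
by rewrite ifF ?IH ?E //; lia.
Qed.

Lemma trim_seq_shift p o ts : trim_seq p.+1 o.+1 ts = trim_seq p o ts.
Proof. by elim: ts o => //= t ts IH o; rewrite addSn ltnS trim_shift IH. Qed.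

Lemma trim_seq_trim_seq p q o ts ts' : (o <= p < q)%N -> trim_seq p o ts = Some ts' ->
  trim_seq q.+1 o ts -> trim_seq q o ts'.
Proof.
elim: ts o ts' => //= t ts IH o ts' opq; have [op pq] := andP opq.
case: (ltnP p (o + nleaves t)) => pl.
  case E: (trim p o t) => [t'|] //= [<-].
  have lE : nleaves t = (nleaves t').+1 by rewrite (trimP op E).1 nleaves_graft.
  rewrite /= lE addnS ltnS; case: ltnP => ql.
    move: (trim_trim opq E); case: (trim q.+1 o t) => [t''|] //= /(_ isT).
    by case: (trim q o t').
  by rewrite trim_seq_shift; case: trim_seq.
case E: (trim_seq p _ ts) => [us|] //= [<-].
rewrite ifF; last lia.
rewrite /= ifF; last lia.
have opq' : (o + nleaves t <= p < q)%N by rewrite pl.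
move: (IH _ _ opq' E); case: (trim_seq q.+1 _ ts) => [us'|] //= /(_ isT).
by case: (trim_seq q _ us).
Qed.

(** A binary tree has one leaf more than it has internal nodes. *)
Definition ninternal (ts : seq bintree) : nat := (nleaves_seq ts - size ts)%N.

Lemma size_nleaves_seq ts : (size ts <= nleaves_seq ts)%N.
Proof. by elim: ts => //= t ts IH; have := nleaves_gt0 t; lia. Qed.

Lemma trim_seq_nodes p o ts us : (o <= p)%N -> trim_seq p o ts = Some us ->
  ninternal ts = (ninternal us).+1.
Proof.
move=> op E; have sE := size_trim_seq E.
suff h : nleaves_seq ts = (nleaves_seq us).+1.
  by rewrite /ninternal h sE subSn // -sE size_nleaves_seq.
elim: ts o us op E {sE} => //= t ts IH o us op; case: ltnP => pl.
  by case E: trim => [t'|] //= [<-] /=; rewrite (trimP op E).1 nleaves_graft.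
by case E: trim_seq => [ts'|] //= [<-] /=; rewrite (IH _ _ pl E) addnS.
Qed.

Lemma trim_seq_exists o ts : ~~ all (pred1 Leaf) ts ->
  exists2 p, (o <= p)%N & trim_seq p o ts.
Proof.
elim: ts o => //= t ts IH o; case: (eqVneq t Leaf) => [->|nt _] /=.
  case/(IH (o + 1)%N) => p h1 h2; exists p; first lia.
  by rewrite ifF; [case: trim_seq h2 | lia].
case: (trim_exists o nt) => p [h1 h2]; exists p; first lia.
by rewrite ifT; [case: trim h2 | lia].
Qed.

(** * Trimming operators on a ring generated by variables *)

(** The monotone bijection from the labels other than [k] to all labels. *)
Definition squeeze (k n : nat) : nat := (n - (k < n))%N.

(** The polynomial ring enters only through these properties: it is generated by
    the variables, which are regular elements, and the substitutions [R k] and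
    the evaluation [ev] at 0 exist. *)
Section Trimming.

Variables (A : comNzRingType) (X : nat -> A).
Variables (R : nat -> {rmorphism A -> A}) (ev : {rmorphism A -> int}).
Hypothesis gen : forall P : A -> Prop,
  (forall c : int, P c%:~R) -> (forall i, P (X i)) ->
  (forall f g, P f -> P g -> P (f + g)) ->
  (forall f g, P f -> P g -> P (f * g)) -> forall f, P f.
Hypothesis mulX_inj : forall i, injective ( *%R (X i)).
Hypothesis RX : forall k j, R k (X j) = if j == k then 0 else X (squeeze k j).
Hypothesis evX : forall i, ev (X i) = 0.

Implicit Types (f g : A).

Lemma RX_lt k j : (j < k)%N -> R k (X j) = X j.
Proof. by move=> h; rewrite RX /squeeze; case: eqP => [|_]; [lia | congr X; lia]. Qed.

Lemma RX_gt k j : (k <= j)%N -> R k (X j.+1) = X j.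
Proof. by move=> h; rewrite RX /squeeze; case: eqP => [|_]; [lia | congr X; lia]. Qed.

(** Both sides put 0 for the variables [b] and [a.+1]. *)
Lemma R_comm a b f : (b <= a)%N -> R a (R b f) = R b (R a.+1 f).
Proof.
move=> ba; elim/gen: f => [c|i|f g hf hg|f g hf hg].
- by rewrite !rmorph_int.
- rewrite RX [in RHS]RX; case: (i =P b) => [->|ib].
    have -> : b == a.+1 = false by apply/eqP; lia.
    rewrite rmorph0 RX.
    by have -> : squeeze a.+1 b == b by apply/eqP; rewrite /squeeze; lia.
  case: (i =P a.+1) => [->|ia].
    rewrite rmorph0 RX.
    by have -> : squeeze b a.+1 == a by apply/eqP; rewrite /squeeze; lia.
  rewrite !RX.
  have -> : squeeze b i == a = false by apply/eqP; rewrite /squeeze; lia.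
  have -> : squeeze a.+1 i == b = false by apply/eqP; rewrite /squeeze; lia.
  congr X; rewrite /squeeze; lia.
- by rewrite !rmorphD hf hg.
- by rewrite !rmorphM hf hg.
Qed.

Lemma ev_R k f : ev (R k f) = ev f.
Proof.
elim/gen: f => [c|i|f g hf hg|f g hf hg].
- by rewrite !rmorph_int.
- by rewrite RX evX; case: eqP => _; rewrite ?rmorph0 ?evX.
- by rewrite !rmorphD hf hg.
- by rewrite !rmorphM hf hg.
Qed.

(** A polynomial contains finitely many variables. *)
Lemma R_id f : exists n, forall k, (n <= k)%N -> R k f = f.
Proof.
elim/gen: f => [c|i|f g [n hf] [m hg]|f g [n hf] [m hg]].
- by exists 0%N => k _; rewrite rmorph_int.
- by exists i.+1 => k; apply: RX_lt.
- by exists (maxn n m) => k; rewrite geq_max rmorphD => /andP[/hf-> /hg->].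
- by exists (maxn n m) => k; rewrite geq_max rmorphM => /andP[/hf-> /hg->].
Qed.

(** Each application of [R 0] kills the first variable and shifts the others
    down, so enough applications leave nothing but the constant term. *)
Lemma R0_const f : R 0 f = f -> f = (ev f)%:~R.
Proof.
move=> h; have hi n : iter n (R 0) f = f by elim: n => //= n ->.
suff [n hn] : exists n, forall k, (n <= k)%N -> iter k (R 0) f = (ev f)%:~R.
  by rewrite -(hn n) ?hi.
elim/gen: {h hi} f => [c|i|f g [n hf] [m hg]|f g [n hf] [m hg]].
- exists 0%N => k _; rewrite [ev _]rmorph_int intz.
  by elim: k => //= k ->; rewrite rmorph_int.
- have xi : iter i (R 0) (X i) = X 0 by elim: i => // i IH; rewrite iterSr RX_gt.
  have h0 n : iter n (R 0) 0 = 0 by elim: n => //= n ->; rewrite rmorph0.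
  exists i.+1 => k ik; rewrite evX -(subnK ik) iterD iterS xi.
  by rewrite RX eqxx h0.
- exists (maxn n m) => k; rewrite geq_max rmorphD => /andP[/hf hf' /hg hg'].
  rewrite intrD -hf' -hg'.
  by elim: (k) => //= k' ->; rewrite rmorphD.
- exists (maxn n m) => k; rewrite geq_max rmorphM => /andP[/hf hf' /hg hg'].
  rewrite intrM -hf' -hg'.
  by elim: (k) => //= k' ->; rewrite rmorphM.
Qed.

(** After [R i.+1] and [R i], the polynomial f reads f(.., x_i, 0, ..) and
    f(.., 0, x_i, ..); these agree for x_i = 0. *)
Lemma T_exists i f : exists g, X i * g == R i.+1 f - R i f.
Proof.
elim/gen: f => [c|j|f g [f' /eqP hf] [g' /eqP hg]|f g [f' /eqP hf] [g' /eqP hg]].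
- by exists 0; rewrite !rmorph_int mulr0 subrr.
(* the trimming of the variable j is 1 for j = i, -1 for j = i+1, else 0 *)
- case: (ltngtP j i) => ji.
  + by exists 0; rewrite !RX_lt ?mulr0 ?subrr // ltnS ltnW.
  + exists (if j == i.+1 then -1 else 0); case: (j =P i.+1) => [->|h].
      by rewrite (RX_gt (leqnn i)) RX eqxx sub0r mulrN1.
    case: j ji h => // j ji h; rewrite !RX_gt ?mulr0 ?subrr //; lia.
  + by exists 1; rewrite ji RX_lt // RX eqxx subr0 mulr1.
- by exists (f' + g'); rewrite !rmorphD mulrDr hf hg; apply/eqP; ring.
- exists (f' * R i.+1 g + R i f * g').
  rewrite mulrDr mulrA hf mulrCA hg !rmorphM; apply/eqP; ring.
Qed.

Definition T (i : nat) (f : A) : A := xchoose (T_exists i f).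

Lemma TE i f : X i * T i f = R i.+1 f - R i f.
Proof. by apply/eqP; apply: (xchooseP (T_exists i f)). Qed.

Lemma T_uniq i f g : X i * g = R i.+1 f - R i f -> T i f = g.
Proof. by rewrite -TE => /mulX_inj. Qed.

Lemma TD i f g : T i (f + g) = T i f + T i g.
Proof. by apply: T_uniq; rewrite mulrDr !TE !rmorphD; ring. Qed.

Lemma T0 i : T i 0 = 0.
Proof. by apply: T_uniq; rewrite !rmorph0 mulr0 subrr. Qed.

HB.instance Definition _ i :=
  GRing.isNmodMorphism.Build A A (T i) (T0 i, TD i).

(** The twisted Leibniz rule. *)
Lemma TM i f g : T i (f * g) = T i f * R i.+1 g + R i f * T i g.
Proof.
apply: T_uniq; rewrite mulrDr mulrA TE mulrCA TE !rmorphM; ring.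
Qed.

(** On forests: two trimmings at different places can be done in either order,
    and the one on the left moves the leaves on its right down by one. *)
Lemma T_comm a b f : (b < a)%N -> T a (T b f) = T b (T a.+1 f).
Proof.
move=> ba; apply: (@mulX_inj a); rewrite TE; apply: (@mulX_inj b).
have h c g : (b < c)%N -> X b * R c g = R c (X b * g).
  by move=> bc; rewrite rmorphM RX_lt.
have -> : X b * (X a * T b (T a.+1 f)) = X a * (X b * T b (T a.+1 f)) by ring.
rewrite mulrBr !h ?TE; try lia.
have h' c g : (c <= a)%N -> X a * R c g = R c (X a.+1 * g).
  by move=> bc; rewrite rmorphM RX_gt.
rewrite mulrBr !h' ?TE ?rmorphB; try lia.
rewrite (R_comm _ (leqW ba)) (R_comm _ (leqW (ltnW ba))).
rewrite (R_comm _ ba) (R_comm _ (ltnW ba)).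
ring.
Qed.

Lemma TR_ge i k f : (k <= i)%N -> T i (R k f) = R k (T i.+1 f).
Proof.
move=> ki; apply: T_uniq; rewrite -[X i](@RX_gt k) // -rmorphM TE rmorphB.
by rewrite (R_comm _ ki) (R_comm _ (leqW ki)).
Qed.

Lemma TR_lt i k f : (i < k)%N -> T i (R k.+1 f) = R k (T i f).
Proof.
move=> ki; apply: T_uniq; rewrite -[X i in LHS](@RX_lt k) // -rmorphM TE rmorphB.
by rewrite (R_comm _ ki) (R_comm _ (ltnW ki)).
Qed.

(** The one case in which commuting [T] and [R] creates a second term: between
    [R k.+1 (R k.+1 f)] and [R k (R k.+1 f)], whose difference the left side
    measures, lies [R k.+1 (R k f) = R k (R k.+2 f)], at distance
    [X k * R k.+1 (T k f)] from one and [X k * R k (T k.+1 f)] from the other. *)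
Lemma TR_eq k f : T k (R k.+1 f) = R k.+1 (T k f) + R k (T k.+1 f).
Proof.
apply: T_uniq; rewrite mulrDr -[X k in X in X + _](@RX_lt k.+1) //.
rewrite -[X k in X in _ + X](@RX_gt k) // -!rmorphM !TE !rmorphB.
rewrite (R_comm _ (leqnSn k)).
ring.
Qed.

Lemma T_eventually0 f : exists n, forall k, (n <= k)%N -> T k f = 0.
Proof.
case: (R_id f) => n hn; exists n => k nk; apply: T_uniq.
by rewrite !hn ?subrr ?mulr0 // ltnW.
Qed.

(** If all trimmings vanish then all [R k f] coincide, and [R k f] is [f] for
    large [k]. *)
Lemma T_const f : (forall i, T i f = 0) -> f = (ev f)%:~R.
Proof.
move=> h; apply: R0_const; case: (R_id f) => n hn.
rewrite -[RHS](hn n) //; elim: n {hn} => // n ->.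
by apply/esym/eqP; rewrite -subr_eq0 -TE h mulr0.
Qed.

Definition varsum (n : nat) : A := \sum_(j < n) X j.

Lemma varsumS n : varsum n.+1 = varsum n + X n.
Proof. exact: big_ord_recr. Qed.

Lemma ev_varsum n : ev (varsum n) = 0.
Proof. by rewrite rmorph_sum big1. Qed.

Lemma R_varsum k n : R k (varsum n) = varsum (squeeze k n).
Proof.
elim: n => [|n IH]; first by rewrite /varsum !big_ord0 rmorph0.
rewrite varsumS rmorphD IH RX /squeeze; case: eqP => [->|h].
  by rewrite ltnn ltnSn addr0; congr varsum; lia.
have -> : (n.+1 - (k < n.+1) = (n - (k < n)).+1)%N by lia.
by rewrite varsumS.
Qed.

Lemma T_varsum_eq i : T i (varsum i.+1) = 1.
Proof.
apply: T_uniq; rewrite !R_varsum /squeeze ltnn ltnSn subn0 varsumS subSS subn0; ring.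
Qed.

Lemma T_varsum_neq i n : n != i.+1 -> T i (varsum n) = 0.
Proof.
move=> h; apply: T_uniq; rewrite !R_varsum mulr0 /squeeze.
by have -> : (i.+1 < n)%N = (i < n)%N by [lia]; rewrite subrr.
Qed.

(** The first letter acts first. *)
Definition Tword (v : seq nat) (f : A) : A := foldl (fun g i => T i g) f v.

Lemma Tword_cons i v f : Tword (i :: v) f = Tword v (T i f).
Proof. by []. Qed.

Lemma Tword_0 v : Tword v 0 = 0.
Proof. by elim: v => //= i v IH; rewrite T0. Qed.

Lemma Tword_D v f g : Tword v (f + g) = Tword v f + Tword v g.
Proof. by elim: v f g => //= i v IH f g; rewrite TD IH. Qed.

HB.instance Definition _ v :=
  GRing.isNmodMorphism.Build A A (Tword v) (Tword_0 v, Tword_D v).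

(** Every functional given by a word takes the value 0 or 1; by [dual_word] the
    coefficients of [f] in the forest polynomials are among these values. *)
Definition mfree f := forall v, ev (Tword v f) = 0 \/ ev (Tword v f) = 1.

Lemma mfree0 : mfree 0.
Proof. by move=> v; left; rewrite !raddf0. Qed.

(** The inductive principle behind every multiplicity-freeness result below. *)
Lemma mfreeT f : (ev f = 0 \/ ev f = 1) -> (forall i, mfree (T i f)) -> mfree f.
Proof. by move=> h0 h [//|i v]; apply: (h i). Qed.

Lemma mfree_T i f : mfree f -> mfree (T i f).
Proof. by move=> h v; apply: (h (i :: v)). Qed.

(** A bound on the length of the words that do not kill [f]; it replaces the
    degree. *)
Fixpoint nilpotent d f : Prop :=
  if d is d'.+1 then forall i, nilpotent d' (T i f) else f = 0.

Lemma nilpotent0 d : nilpotent d 0.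
Proof. by elim: d => //= d IH i; rewrite T0. Qed.

Lemma nilpotentD d f g : nilpotent d f -> nilpotent d g -> nilpotent d (f + g).
Proof.
elim: d f g => /= [f g -> ->|d IH f g hf hg i]; first by rewrite addr0.
by rewrite TD; apply: IH.
Qed.

Lemma nilpotentS d f : nilpotent d f -> nilpotent d.+1 f.
Proof.
elim: d f => [f /= -> i|d IH f hf i]; first by rewrite T0.
by apply: IH; apply: hf.
Qed.

Lemma nilpotent_leq d e f : (d <= e)%N -> nilpotent d f -> nilpotent e f.
Proof.
move/subnKC <-; elim: (e - d)%N => [|n IH] h; first by rewrite addn0.
by rewrite addnS; apply/nilpotentS/IH.
Qed.

Lemma nilpotentR d k f : nilpotent d f -> nilpotent d (R k f).
Proof.
elim: d k f => /= [k f ->|d IH k f hf i]; first by rewrite rmorph0.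
case: (leqP k i) => ki; first by rewrite TR_ge //; apply: IH.
case: k ki => // k; rewrite ltnS leq_eqVlt => /orP[/eqP <-|ki].
  by rewrite TR_eq; apply: nilpotentD; apply: IH.
by rewrite TR_lt //; apply: IH.
Qed.

(** By the twisted Leibniz rule each trimming of [f * g] spends a trimming on
    one of the two factors. *)
Lemma nilpotentM d e f g :
  nilpotent d.+1 f -> nilpotent e.+1 g -> nilpotent (d + e).+1 (f * g).
Proof.
elim: d e f g => [|d IHd].
  elim=> [|e IH] f g hf hg i; rewrite TM (hf i) mul0r add0r.
    by rewrite (hg i) mulr0.
  by apply: IH; [move=> j; apply: (@nilpotentR 1) | apply: hg].
elim=> [|e IH] f g hf hg i; rewrite TM.
  rewrite (hg i) mulr0 addr0 -[(d.+1 + 0)%N]/(d + 0).+1.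
  by apply: IHd; [apply: hf | apply: (@nilpotentR 1)].
rewrite -[(d.+1 + e.+1)%N]/(d + e.+1).+1; apply: (@nilpotentD (d + e.+1).+1).
  by apply: IHd; [apply: hf | apply: (@nilpotentR e.+2)].
by rewrite addnS -addSn; apply: IH; [apply: (@nilpotentR d.+2) | apply: hg].
Qed.

Lemma nilpotent_exists f : exists d, nilpotent d f.
Proof.
elim/gen: f => [c|i|f g [d hf] [e hg]|f g [d hf] [e hg]].
- by exists 1%N => i; apply: T_uniq; rewrite !rmorph_int subrr mulr0.
(* partial sums are easier than variables: their trimmings are 0 or 1 *)
- have h n : nilpotent 2 (varsum n).
    move=> j k; case: (n =P j.+1) => [->|/eqP h]; last by rewrite T_varsum_neq // T0.
    by rewrite T_varsum_eq; apply: T_uniq; rewrite !rmorph1 subrr mulr0.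
  exists 2%N; have -> : X i = varsum i.+1 + varsum i * (-1) by rewrite varsumS; ring.
  apply: (@nilpotentD 2) => //; apply: (@nilpotentM 1 0) => // j.
  by apply: T_uniq; rewrite !rmorphN1 subrr mulr0.
- exists (maxn d e); apply: (@nilpotentD (maxn d e)).
    exact: nilpotent_leq (leq_maxl _ _) hf.
  exact: nilpotent_leq (leq_maxr _ _) hg.
- exists (d + e).+1; apply: nilpotentM; exact: nilpotentS.
Qed.

(** * Forest polynomials of sequences of trees *)

(** The generating function of the labellings of a tree whose leftmost leaf has
    the number [o]: the label of a node is less than the value of [w] at its
    leftmost leaf, and the label of the root is at least [m].  Forest
    polynomials have [w = S]; general bounds [w] make the family stable under
    the substitutions [R k], and general [m] makes it recursive. *)
Fixpoint tree_poly (w : nat -> nat) (t : bintree) (o m : nat) : A :=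
  if t is Node l r then
    \sum_(m <= k < w o) X k * (tree_poly w l o k * tree_poly w r (o + nleaves l) k.+1)
  else 1.

Fixpoint trees_poly (w : nat -> nat) (ts : seq bintree) (o : nat) : A :=
  if ts is t :: ts' then tree_poly w t o 0 * trees_poly w ts' (o + nleaves t) else 1.

Lemma tree_poly_ext w w' t o o' m :
  (forall q, (q < nleaves t)%N -> w (o + q)%N = w' (o' + q)%N) ->
  tree_poly w t o m = tree_poly w' t o' m.
Proof.
elim: t o o' m => //= l hl r hr o o' m h.
have h0 : w o = w' o' by rewrite -(addn0 o) h ?addn0 // addn_gt0 nleaves_gt0.
rewrite h0; apply: eq_bigr => k _; congr (_ * (_ * _)).
  by apply: hl => q ql; apply: h; lia.
by apply: hr => q ql; rewrite -!addnA; apply: h; lia.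
Qed.

Lemma trees_poly_ext w w' ts o o' :
  (forall q, w (o + q)%N = w' (o' + q)%N) -> trees_poly w ts o = trees_poly w' ts o'.
Proof.
elim: ts o o' => //= t ts IH o o' h; congr (_ * _); first exact: tree_poly_ext.
by apply: IH => q; rewrite -!addnA h.
Qed.

Lemma sum_squeeze k m b (F : nat -> A) :
  \sum_(m <= j < b) (if j == k then 0 else F (squeeze k j))
  = \sum_(squeeze k m <= j < squeeze k b) F j.
Proof.
case: (leqP b m) => [bm|mb].
  by rewrite !big_geq // /squeeze; lia.
elim: b mb => // b IH; rewrite ltnS leq_eqVlt => /orP[/eqP <-|mb].
  rewrite big_nat1; case: eqP => [->|h]; first by rewrite big_geq // /squeeze; lia.
  have -> : squeeze k m.+1 = (squeeze k m).+1 by rewrite /squeeze; lia.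
  by rewrite big_nat1.
rewrite big_nat_recr /=; last exact: ltnW.
rewrite IH //; case: eqP => [->|h].
  by rewrite addr0; congr (\sum_(_ <= _ < _) _); rewrite /squeeze; lia.
have -> : squeeze k b.+1 = (squeeze k b).+1 by rewrite /squeeze; lia.
by rewrite big_nat_recr //= /squeeze; lia.
Qed.

(** [R k] keeps the labellings that avoid the label [k], and [squeeze k] renames
    their labels. *)
Lemma R_tree_poly k w t o m :
  R k (tree_poly w t o m) = tree_poly (squeeze k \o w) t o (squeeze k m).
Proof.
elim: t o m => [|l hl r hr] o m /=; first by rewrite rmorph1.
rewrite -(sum_squeeze k m (w o) (fun j => X j * (tree_poly (squeeze k \o w) l o j *
   tree_poly (squeeze k \o w) r (o + nleaves l) j.+1))) rmorph_sum /=.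
apply: eq_bigr => j _; rewrite !rmorphM RX hl hr; case: eqP => h.
  by rewrite mul0r.
by congr (_ * (_ * tree_poly _ _ _ _)); rewrite /squeeze; lia.
Qed.

Lemma R_trees_poly k w ts o : R k (trees_poly w ts o) = trees_poly (squeeze k \o w) ts o.
Proof.
elim: ts o => [|t ts IH] o /=; first by rewrite rmorph1.
by rewrite rmorphM R_tree_poly IH.
Qed.

(** Two systems of bounds that differ only at the leaf [p], by one.  The label
    [b] is the one that [w] allows there and [w'] does not; [w''] is what [w]
    becomes when the leaf [p.+1] disappears. *)
Section Difference.

Variables (w w' w'' : nat -> nat) (p b : nat).
Hypothesis ww' : forall q, q != p -> w q = w' q.
Hypothesis wp : w p = b.+1.
Hypothesis w'p : w' p = b.
Hypothesis wp1 : w p.+1 = b.+1.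
Hypothesis w_lt : forall q, (q < p)%N -> (w q <= b)%N.
Hypothesis w''_le : forall q, (q <= p)%N -> w'' q = w q.
Hypothesis w''_gt : forall q, (p < q)%N -> w'' q = w q.+1.

Lemma tree_poly_head u t o m : t != Leaf -> (u o <= m)%N -> tree_poly u t o m = 0.
Proof. by case: t => //= l r _ h; rewrite big_geq. Qed.

(** If [p] is not the leftmost leaf of the tree, the difference comes from the
    subtree that contains [p].  If it is, then each root label below [b]
    contributes the difference of the left subtree, and there is one more term,
    in which the root has the label [b].  If the left subtree is not a leaf, this
    term has the same form: with lower bound [b] its polynomial for [w'] is 0,
    since [w' p = b], so its polynomial for [w] is its own difference.  If the
    left subtree is a leaf, only the term with root label [b] remains, and it is
    0 unless the right subtree is a leaf too, since the root of the right subtree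
    would need a label which is at least [b.+1] and less than [w p.+1 = b.+1]. *)
Lemma tree_poly_diff t o m : (o <= p < o + nleaves t)%N -> (m <= b)%N ->
  tree_poly w t o m - tree_poly w' t o m =
  if trim p o t is Some t' then X b * tree_poly w'' t' o m else 0.
Proof.
elim: t o m => [|l hl r hr] o m op mb; first by rewrite /= subrr.
have [op1 op2] := andP op; move: op2 => /= op2.
case: (ltnP p (o + nleaves l)) => pl; last first.
  have np : (p == o) = false by have := nleaves_gt0 l; lia.
  have wo : w o = w' o by rewrite ww' // eq_sym np.
  have w''o : w'' o = w o by rewrite w''_le.
  have wob : (w o <= b)%N by apply: w_lt; have := nleaves_gt0 l; lia.
  rewrite np /= -wo -sumrB.
  transitivity (\sum_(m <= k < w o) X k * (tree_poly w l o k *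
     (if trim p (o + nleaves l) r is Some t'
      then X b * tree_poly w'' t' (o + nleaves l) k.+1 else 0))).
    rewrite big_nat_cond [RHS]big_nat_cond; apply: eq_bigr => k /andP[/andP[mk kw] _].
    rewrite -hr; [|lia|lia]; rewrite -mulrBr; congr (_ * _).
    rewrite (@tree_poly_ext w' w l o o k) ?mulrBr // => q ql; rewrite ww' //; lia.
  case: trim => [r'|] /=; last by rewrite big1 // => k _; rewrite !mulr0.
  rewrite big_distrr w''o /=; apply: eq_bigr => k _.
  rewrite (@tree_poly_ext w'' w l o o k); first ring.
  by move=> q ql; rewrite w''_le //; lia.
have tr k : tree_poly w' r (o + nleaves l) k.+1 = tree_poly w r (o + nleaves l) k.+1.
  by apply: tree_poly_ext => q _; rewrite ww' //; lia.
have hl' k : (k <= b)%N -> tree_poly w l o k = tree_poly w' l o k +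
    (if trim p o l is Some t' then X b * tree_poly w'' t' o k else 0).
  by move=> kb; rewrite -hl //; [ring | lia].
have tr'' l' k : trim p o l = Some l' ->
    tree_poly w r (o + nleaves l) k = tree_poly w'' r (o + nleaves l') k.
  move=> E; have [lE pl'] := trimP op1 E; apply: tree_poly_ext => q _.
  by rewrite lE nleaves_graft addnS addSn w''_gt //; lia.
case: (ltngtP o p) => [op'|?|eop]; [|lia|].
  have wo : w o = w' o by rewrite ww' //; lia.
  have w''o : w'' o = w o by rewrite w''_le.
  have wob : (w o <= b)%N by apply: w_lt.
  rewrite /= -wo -sumrB /=.
  transitivity (\sum_(m <= k < w o) X k * (
     (if trim p o l is Some t' then X b * tree_poly w'' t' o k else 0)
       * tree_poly w r (o + nleaves l) k.+1)).
    rewrite big_nat_cond [RHS]big_nat_cond; apply: eq_bigr => k /andP[/andP[mk kw] _].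
    by rewrite tr hl' 1?mulrDl 1?mulrDr 1?addrAC ?subrr ?add0r //; lia.
  case E: (trim p o l) => [l'|] /=; last by rewrite big1 // => k _; rewrite mul0r mulr0.
  rewrite big_distrr w''o /=; apply: eq_bigr => k _.
  by rewrite (tr'' _ _ E); ring.
subst o; rewrite /= wp w'p big_nat_recr //= addrAC -sumrB.
case: (eqVneq l Leaf) => [lE|nl] /=.
  rewrite big_nat_cond big1 ?add0r => [|k _]; last by rewrite tr lE subrr.
  case: (eqVneq r Leaf) => [rE|nr] /=.
    by rewrite lE rE /= !mulr1.
  by rewrite (tree_poly_head nr) ?lE /= ?addn1 ?wp1 // !mulr0.
transitivity (\sum_(m <= k < b.+1) X k * (
     (if trim p p l is Some t' then X b * tree_poly w'' t' p k else 0)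
       * tree_poly w r (p + nleaves l) k.+1)).
  rewrite [RHS]big_nat_recr //=; congr (_ + _).
    rewrite big_nat_cond [RHS]big_nat_cond; apply: eq_bigr => k /andP[/andP[mk kw] _].
    by rewrite tr hl' 1?mulrDl 1?mulrDr 1?addrAC ?subrr ?add0r //; lia.
  by rewrite hl' // (tree_poly_head nl) ?w'p // add0r.
case E: (trim p p l) => [l'|] /=; last by rewrite big1 // => k _; rewrite mul0r mulr0.
rewrite big_distrr w''_le // wp /=; apply: eq_bigr => k _.
by rewrite (tr'' _ _ E); ring.
Qed.

Lemma trees_poly_diff ts o : (o <= p)%N ->
  trees_poly w ts o - trees_poly w' ts o =
  if trim_seq p o ts is Some ts' then X b * trees_poly w'' ts' o else 0.
Proof.
elim: ts o => [|t ts IH] o op /=; first by rewrite subrr.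
case: ltnP => pl.
  have -> : trees_poly w' ts (o + nleaves t) = trees_poly w ts (o + nleaves t).
    by apply: trees_poly_ext => q; rewrite ww' //; lia.
  rewrite -mulrBl tree_poly_diff ?op //.
  case E: trim => [t'|] /=; last by rewrite mul0r.
  rewrite -mulrA; congr (_ * (_ * _)); have [tE pl'] := trimP op E.
  by apply: trees_poly_ext => q; rewrite tE nleaves_graft addnS addSn w''_gt //; lia.
have -> : tree_poly w' t o 0 = tree_poly w t o 0.
  by apply: tree_poly_ext => q ql; rewrite ww' //; lia.
rewrite -mulrBr IH //; case: trim_seq => [ts'|] /=; last by rewrite mulr0.
rewrite mulrCA; congr (_ * (_ * _)).
by apply: tree_poly_ext => q ql; rewrite w''_le //; lia.
Qed.

End Difference.

(** The label of a node is at most the number [n] of its leftmost leaf, hence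
    less than [S n]. *)
Definition standard_poly (ts : seq bintree) : A := trees_poly S ts 0.

(** Under [R i.+1] the leaves [i] and [i.+1] both get the bound [i.+1]; under
    [R i] the leaf [i] gets [i] instead, and all other bounds are the same.
    Without the leaf [i.+1] the first system of bounds is [S] again. *)
Lemma T_standard_poly i ts :
  T i (standard_poly ts) =
  if trim_seq i 0 ts is Some us then standard_poly us else 0.
Proof.
apply: T_uniq; rewrite !R_trees_poly.
rewrite (@trees_poly_diff _ _ S i i) //; rewrite /squeeze /=.
- by case: trim_seq => [us|] //; rewrite mulr0.
- by move=> q h; lia.
- lia.
- lia.
- lia.
- by move=> q h; lia.
- by move=> q h; lia.
- by move=> q h; lia.
Qed.

Lemma ev_tree_poly w t o m : ev (tree_poly w t o m) = (t == Leaf)%:R.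
Proof.
case: t => [|l r] /=; first by rewrite rmorph1.
by rewrite rmorph_sum big1 // => k _; rewrite rmorphM evX mul0r.
Qed.

Lemma ev_standard_poly ts : ev (standard_poly ts) = (all (pred1 Leaf) ts)%:R.
Proof.
rewrite /standard_poly; elim: ts 0%N => [|t ts IH] o /=; first by rewrite rmorph1.
by rewrite rmorphM ev_tree_poly IH -natrM mulnb.
Qed.

Lemma standard_poly_trim_cases i ts :
  T i (standard_poly ts) = 0 \/
  exists us, [/\ T i (standard_poly ts) = standard_poly us, trim_seq i 0 ts = Some us
               & ninternal ts = (ninternal us).+1].
Proof.
rewrite T_standard_poly; case E: trim_seq => [us|]; last by left.
by right; exists us; split => //; apply: trim_seq_nodes E.
Qed.

Lemma ev_standard_poly01 ts : ev (standard_poly ts) = 0 \/ ev (standard_poly ts) = 1.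
Proof. by rewrite ev_standard_poly; case: all; [right | left]. Qed.

(** The two terms of [TR_eq] come from trimmings at consecutive leaves, so at most
    one of them survives. *)
Lemma mfree_R_standard_poly ts k : mfree (R k (standard_poly ts)).
Proof.
move: {2}(ninternal ts).+1 (ltnSn (ninternal ts)) => n.
elim: n ts k => // n IH ts k tn; apply: mfreeT => [|i].
  by rewrite ev_R; apply: ev_standard_poly01.
have IH' j l : mfree (R l (T j (standard_poly ts))).
  case: (standard_poly_trim_cases j ts) => [->|[us [-> _ h]]].
    by rewrite rmorph0; apply: mfree0.
  by apply: IH; rewrite -ltnS -h.
case: (leqP k i) => ki; first by rewrite TR_ge.
case: k ki => // k; rewrite ltnS leq_eqVlt => /orP[/eqP <-|ki]; last first.
  by rewrite TR_lt.
rewrite TR_eq !T_standard_poly; move: (IH' i i.+1) (IH' i.+1 i); rewrite !T_standard_poly.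
have := @trim_seq_next i 0 ts (leq0n _); case: (trim_seq i 0 ts) => [us|].
  by move=> -> //; rewrite rmorph0 addr0.
by rewrite rmorph0 add0r.
Qed.

Lemma T_varsumM i m f : m != i.+1 -> T i (varsum m * f) = varsum (squeeze i m) * T i f.
Proof. by move=> h; rewrite TM T_varsum_neq // mul0r add0r R_varsum. Qed.

Lemma T_varsumM_eq j f : T j (varsum j.+1 * f) = R j.+1 f + varsum j * T j f.
Proof. by rewrite TM T_varsum_eq mul1r R_varsum /squeeze ltnSn subn1. Qed.

(** The critical case is [m = i.+1] with [i] and [i.+1] sibling leaves.  There
    [T i (varsum i.+1 * f)] is trimmed once more, at [k], with [f] the forest
    polynomial.  For [k] different from [i] and [i.-1] the commutation rule
    [T_comm] puts the trimming of [f] first.  For [k = i] and [k = i.-1] the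
    extra term of [T_varsumM_eq] is used, and the neighbouring trimmings of [f]
    vanish. *)
Lemma mfree_varsum_standard_poly m ts : mfree (varsum m * standard_poly ts).
Proof.
move: {2}(ninternal ts).+1 (ltnSn (ninternal ts)) => n.
elim: n ts m => // n IH ts m tn; apply: mfreeT => [|i].
  by left; rewrite rmorphM ev_varsum mul0r.
have IH' j l : mfree (varsum l * T j (standard_poly ts)).
  case: (standard_poly_trim_cases j ts) => [->|[us [-> _ h]]].
    by rewrite mulr0; apply: mfree0.
  by apply: IH; rewrite -ltnS -h.
case: (eqVneq m i.+1) => [->|mi]; last by rewrite T_varsumM.
case E: (trim_seq i 0 ts) => [us|]; last first.
  rewrite T_varsumM_eq [T i _]T_standard_poly E mulr0 addr0; exact: mfree_R_standard_poly.
have Tnext : T i.+1 (standard_poly ts) = 0 by rewrite T_standard_poly trim_seq_next // E.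
apply: mfreeT => [|k].
  rewrite T_varsumM_eq rmorphD rmorphM ev_varsum mul0r addr0 ev_R.
  exact: ev_standard_poly01.
case: (ltngtP k i) => ki.
- case: i E Tnext ki => // i E Tnext; rewrite ltnS leq_eqVlt => /orP[/eqP ->|ki].
    rewrite T_varsumM_eq TD TR_lt //.
    have -> : T i (standard_poly ts) = 0.
      rewrite T_standard_poly; case E': trim_seq => [vs|] //.
      by move: E; rewrite trim_seq_next // E'.
    by rewrite rmorph0 add0r; apply: mfree_T.
  rewrite -(T_comm _ ki) T_varsumM; last lia.
  have -> : squeeze k i.+2 = i.+1 by rewrite /squeeze; lia.
  exact: mfree_T.
- rewrite T_comm // T_varsumM; last lia.
  by apply: mfree_T; apply: IH'.
- rewrite {}ki T_varsumM_eq TD TR_eq Tnext rmorph0 addr0 T_varsumM; last lia.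
  have -> : squeeze i i = i by rewrite /squeeze; lia.
  rewrite -T_varsumM_eq; exact: mfree_T.
Qed.

(** * Expansion in forest polynomials *)

Lemma trim_seq_pad p o ts n :
  trim_seq p o (ts ++ nseq n Leaf) = omap (cat^~ (nseq n Leaf)) (trim_seq p o ts).
Proof.
elim: ts o => /= [|t ts IH] o; last first.
  by rewrite IH; case: ifP => _; [case: trim | case: trim_seq].
by elim: n o => //= n IH o; rewrite IH if_same.
Qed.

Lemma nleaves_seq_pad ts n : nleaves_seq (ts ++ nseq n Leaf) = (nleaves_seq ts + n)%N.
Proof.
by elim: ts => /= [|t ts ->]; [elim: n => //= n -> | rewrite addnA].
Qed.

Lemma ninternal_pad ts n : ninternal (ts ++ nseq n Leaf) = ninternal ts.
Proof. by rewrite /ninternal nleaves_seq_pad size_cat size_nseq subnDr. Qed.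

Lemma standard_poly_pad ts n : standard_poly (ts ++ nseq n Leaf) = standard_poly ts.
Proof.
rewrite /standard_poly; elim: ts 0%N => /= [|t ts IH] o; last by rewrite IH.
by elim: n o => //= n IH o; rewrite IH mul1r.
Qed.

Lemma nilpotentMz d f (c : int) : nilpotent d f -> nilpotent d (f *~ c).
Proof.
elim: d f => /= [f ->|d IH f hf i]; first by rewrite mul0rz.
by rewrite raddfMz; apply: IH; apply: hf.
Qed.

Lemma nilpotent_standard_poly d ts :
  (ninternal ts < d)%N -> nilpotent d (standard_poly ts).
Proof.
elim: d ts => //= d IH ts td i.
case: (standard_poly_trim_cases i ts) => [->|[us [-> _ h]]].
  exact: nilpotent0.
by apply: IH; rewrite -ltnS -h.
Qed.

(** Induction on [d], then on [m].  An expansion of [T m f] is available; grafting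
    a node at the leaf [m] onto each of its forests gives a polynomial [g] with
    [T m g = T m f].  As the forests of [T m f] cannot be trimmed at [m.+1] or
    later, those of [g] cannot be trimmed after [m], and so [f - g] is killed by
    [T i] for every [i] from [m] on. *)
Lemma span_T d m f : nilpotent d f -> (forall i, (m <= i)%N -> T i f = 0) ->
  exists2 r : seq (int * seq bintree), f = \sum_(q <- r) standard_poly q.2 *~ q.1 &
    forall q, q \in r -> (ninternal q.2 < d)%N /\
      forall i, (m <= i)%N -> trim_seq i 0 q.2 = None.
Proof.
elim: d m f => [|d IHd]; first by move=> m f /= -> _; exists [::]; rewrite ?big_nil.
elim=> [|m IHm] f hf fm.
  exists [:: (ev f, [::])]; last by move=> q; rewrite inE => /eqP ->.
  by rewrite big_seq1 /= -T_const // => i; apply: fm.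
have [||r fr hr] := IHd m.+1 (T m f).
- exact: hf.
- by move=> i mi; rewrite T_comm // fm ?T0 // ltnW.
(* the padding makes sure that the leaf m exists *)
pose lft ts := graft_seq m 0 (ts ++ nseq m.+1 Leaf).
have lftK ts : trim_seq m 0 (lft ts) = Some (ts ++ nseq m.+1 Leaf).
  by apply: graft_seqK; rewrite nleaves_seq_pad; lia.
have lft_nodes ts : ninternal (lft ts) = (ninternal ts).+1.
  by rewrite (trim_seq_nodes (leq0n m) (lftK ts)) ninternal_pad.
have lft_none ts i : (forall j, (m < j)%N -> trim_seq j 0 ts = None) -> (m < i)%N ->
    trim_seq i 0 (lft ts) = None.
  move=> h; case: i => // i; rewrite ltnS leq_eqVlt => /orP[/eqP <-|mi].
    by rewrite trim_seq_next // lftK.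
  move: (@trim_seq_trim_seq m i 0 _ _ mi (lftK ts)); rewrite trim_seq_pad h //.
  by case: trim_seq => [us|] // /(_ isT).
pose g := \sum_(q <- r) standard_poly (lft q.2) *~ q.1.
have [||r' fr' hr'] := IHm (f - g).
- have -> : f - g = f + \sum_(q <- r) standard_poly (lft q.2) *~ (- q.1).
    by congr (_ + _); rewrite -sumrN; apply: eq_bigr => q _; rewrite mulrNz.
  apply: (@nilpotentD d.+1) => //; rewrite big_seq.
  apply: (big_ind (nilpotent d.+1)) => [|a b ha hb|q qr].
  + exact: nilpotent0.
  + exact: (@nilpotentD d.+1).
  + apply: (@nilpotentMz d.+1); apply: nilpotent_standard_poly.
    by rewrite lft_nodes ltnS (hr q qr).1.
- move=> i; rewrite raddfB /= raddf_sum /= leq_eqVlt => /orP[/eqP <-|mi].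
    rewrite fr; apply/eqP; rewrite subr_eq0; apply/eqP/eq_bigr => q _.
    by rewrite raddfMz /= T_standard_poly lftK standard_poly_pad.
  rewrite fm // sub0r big_seq big1 ?oppr0 // => q qr.
  by rewrite raddfMz /= T_standard_poly lft_none ?mul0rz // => j; apply: (hr q qr).2.
exists ([seq (q.1, lft q.2) | q <- r] ++ r').
  by rewrite big_cat -fr' big_map /= addrC subrK.
move=> q; rewrite mem_cat => /orP[/mapP[q' qr ->]|qr].
  have [h1 h2] := hr q' qr; split=> [|i mi /=]; first by rewrite lft_nodes ltnS.
  exact: lft_none.
have [h1 h2] := hr' q qr; split=> // i mi; apply: h2; exact: ltnW.
Qed.

Lemma span f :
  exists r : seq (int * seq bintree), f = \sum_(q <- r) standard_poly q.2 *~ q.1.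
Proof.
have [d hd] := nilpotent_exists f; have [m hm] := T_eventually0 f.
by have [r fr _] := span_T hd hm; exists r.
Qed.

(** The word strips the nodes of [ts] one by one.  By injectivity of trimming, any
    other sequence of the same length is killed on the way or still has nodes at
    the end, and then its polynomial vanishes at 0. *)
Lemma dual_word ts : exists v, forall ts', size ts' = size ts ->
  ev (Tword v (standard_poly ts')) = (ts' == ts)%:R.
Proof.
move: {2}(ninternal ts).+1 (ltnSn (ninternal ts)) => n.
elim: n ts => // n IH ts tn.
case: (boolP (all (pred1 Leaf) ts)) => [tl|/(trim_seq_exists 0)[p _]].
  exists [::] => ts' sts'; rewrite /= ev_standard_poly; congr (_%:R).
  have allE us : all (pred1 Leaf) us = (us == nseq (size us) Leaf).
    exact/all_pred1P/eqP.
  by rewrite [in RHS](eqP (etrans (esym (allE ts)) tl)) allE sts'.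
case E: (trim_seq p 0 ts) => [us|] // _; case: (IH us) => [|v hv].
  by rewrite -ltnS -(trim_seq_nodes (leq0n p) E).
exists (p :: v) => ts' sts'; rewrite Tword_cons T_standard_poly.
case E': (trim_seq p 0 ts') => [us'|]; last first.
  rewrite Tword_0 rmorph0; case: eqP => // h.
  by move: E'; rewrite h E.
rewrite hv; last by rewrite (size_trim_seq E) (size_trim_seq E').
congr (nat_of_bool _)%:R; apply/idP/idP => /eqP => [uu|tt]; apply/eqP.
  by rewrite (trim_seqP (leq0n p) E) (trim_seqP (leq0n p) E') uu.
by move: E'; rewrite tt E => -[].
Qed.

(** The sequences of an expansion are first padded to a common length, so that
    equal forests are equal sequences and [dual_word] applies. *)
Lemma mfree_expansion f : mfree f ->
  exists N, exists2 s : seq (seq bintree), uniq s &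
    (forall ts, ts \in s -> size ts = N) /\ f = \sum_(ts <- s) standard_poly ts.
Proof.
move=> hf; have [r fr] := span f.
pose N := \max_(q <- r) size q.2.
pose pad (ts : seq bintree) := ts ++ nseq (N - size ts) Leaf.
pose s0 := undup [seq pad q.2 | q <- r].
have s0N ts : ts \in s0 -> size ts = N.
  rewrite mem_undup => /mapP[q qr ->]; rewrite size_cat size_nseq subnKC //.
  by rewrite /N (big_rem q) //= leq_maxl.
pose c ts := \sum_(q <- r | pad q.2 == ts) q.1.
have fc : f = \sum_(ts <- s0) standard_poly ts *~ c ts.
  rewrite fr.
  transitivity (\sum_(q <- r) \sum_(ts <- s0 | ts == pad q.2) standard_poly ts *~ q.1).
    rewrite big_seq [RHS]big_seq; apply: eq_bigr => q qr.
    have qs0 : pad q.2 \in s0 by rewrite mem_undup; apply/mapP; exists q.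
    rewrite -big_filter (filter_pred1_uniq (undup_uniq _) qs0) big_seq1.
    by rewrite standard_poly_pad.
  rewrite (exchange_big_dep predT) //=; apply: eq_bigr => ts _.
  by rewrite /c mulrz_sumr; apply: eq_bigl => q; rewrite eq_sym.
have c01 ts : ts \in s0 -> c ts = 0 \/ c ts = 1.
  move=> ts0; have [v hv] := dual_word ts; suff <- : ev (Tword v f) = c ts by [].
  rewrite fc raddf_sum rmorph_sum /= (bigD1_seq ts) ?undup_uniq //=.
  rewrite big_seq_cond big1 => [|us /andP[us0 ut]].
    by rewrite raddfMz raddfMz /= hv // eqxx addr0 intz.
  by rewrite raddfMz raddfMz /= hv ?(s0N us) ?s0N // (negPf ut) mul0rz.
exists N; exists [seq ts <- s0 | c ts == 1]; first by rewrite filter_uniq ?undup_uniq.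
split=> [ts|]; first by rewrite mem_filter => /andP[_]; apply: s0N.
rewrite big_filter fc [in RHS]big_mkcond /= big_seq [RHS]big_seq.
by apply: eq_bigr => ts /c01[] ->.
Qed.

Lemma varsum_standard_poly_expansion m ts :
  exists N, exists2 s : seq (seq bintree), uniq s &
    (forall us, us \in s -> size us = N) /\
    varsum m * standard_poly ts = \sum_(us <- s) standard_poly us.
Proof. exact/mfree_expansion/mfree_varsum_standard_poly. Qed.

End Trimming.

(** * Enumeration of compatible labellings *)

(** Labellings as lists of labels, in the order of [internals]. *)
Fixpoint tree_labels (w : nat -> nat) (t : bintree) (o m : nat) : seq (seq nat) :=
  if t is Node l r then
    flatten [seq [seq k :: a ++ b | a <- tree_labels w l o k,
                                    b <- tree_labels w r (o + nleaves l) k.+1]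
            | k <- index_iota m (w o)]
  else [:: [::]].

Fixpoint trees_labels (w : nat -> nat) (ts : seq bintree) (o : nat) : seq (seq nat) :=
  if ts is t :: ts' then
    [seq a ++ b | a <- tree_labels w t o 0, b <- trees_labels w ts' (o + nleaves t)]
  else [:: [::]].

(** Compatibility in the recursive form that matches [tree_poly]. *)
Fixpoint tree_ok (w : nat -> nat) (t : bintree) (o m : nat)
    (K : treepath -> nat) : bool :=
  if t is Node l r then
    [&& (m <= K [::] < w o)%N, tree_ok w l o (K [::]) (K \o cons false)
      & tree_ok w r (o + nleaves l) (K [::]).+1 (K \o cons true)]
  else true.

Lemma eq_tree_ok w t o m K K' : K =1 K' -> tree_ok w t o m K = tree_ok w t o m K'.
Proof.
elim: t o m K K' => //= l hl r hr o m K K' e; rewrite e; congr [&& _, _ & _].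
  by apply: hl => p /=; rewrite e.
by apply: hr => p /=; rewrite e.
Qed.

Lemma size_tree_labels w t o m s :
  s \in tree_labels w t o m -> size s = size (internals t).
Proof.
elim: t o m s => [|l hl r hr] o m s /=; first by rewrite inE => /eqP ->.
case/flatten_mapP => k _ /allpairsP[[a b] /= [/hl ha /hr hb ->]] /=.
by rewrite !size_cat !size_map ha hb.
Qed.

Lemma tree_labels_uniq w t o m : uniq (tree_labels w t o m).
Proof.
elim: t o m => //= l hl r hr o m.
have : uniq (index_iota m (w o)) by apply: iota_uniq.
elim: (index_iota _ _) => //= k ks IH /andP[kks uks]; rewrite cat_uniq IH // andbT.
apply/andP; split.
  apply: allpairs_uniq => // -[a b] [a' b'] /allpairsP[[c d] /= [hc hd [-> ->]]].
  case/allpairsP=> -[c' d'] /= [hc' hd' [-> ->]] [] /eqP.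
  rewrite eqseq_cat; last by rewrite (size_tree_labels hc) (size_tree_labels hc').
  by case/andP => /eqP -> /eqP ->.
apply/hasPn => s /flatten_mapP[k' k'ks /allpairsP[[a b] /= [_ _ ->]]].
apply/negP => /allpairsP[[a' b'] /= [_ _ [kk _]]].
by move: kks; rewrite -kk k'ks.
Qed.

Lemma tree_labelsP w t o m s :
  s \in tree_labels w t o m <-> exists2 K, tree_ok w t o m K & s = map K (internals t).
Proof.
elim: t o m s => [|l hl r hr] o m s /=.
  by rewrite inE; split=> [/eqP ->|[_ _ ->]] //; exists (fun=> 0%N).
split.
  case/flatten_mapP => k; rewrite mem_index_iota => hk.
  case/allpairsP => -[a b] /= [/hl[Ka oka ->] /hr[Kb okb ->] ->].
  exists (fun p => if p is c :: p' then (if c then Kb p' else Ka p') else k).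
    rewrite /= hk (eq_tree_ok _ _ _ _ (K' := Ka)) // oka.
    by rewrite (eq_tree_ok _ _ _ _ (K' := Kb)).
  by rewrite /= map_cat -!map_comp.
case=> K /and3P[hk okl okr] ->; apply/flatten_mapP; exists (K [::]).
  by rewrite mem_index_iota.
apply/allpairsP; exists (map (K \o cons false) (internals l),
  map (K \o cons true) (internals r)); rewrite /= map_cat -!map_comp.
by split=> //; [apply/hl; exists (K \o cons false) | apply/hr; exists (K \o cons true)].
Qed.

Lemma mem_leaves_leftmost t p : p \in internals t ->
  p ++ leftmost (subtree t p) \in leaves t.
Proof.
have h0 u : leftmost u \in leaves u.
  by elim: u => //= l hl r _; rewrite mem_cat map_f.
elim: t p => //= l hl r hr p; rewrite inE => /orP[/eqP ->|].
  by rewrite /= mem_cat map_f.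
rewrite !mem_cat => /orP[] /mapP[p' hp ->] /=; apply/orP.
  by left; rewrite map_f ?hl.
by right; rewrite map_f ?hr.
Qed.

Lemma cons_inj (I : eqType) (a : I) : injective (cons a).
Proof. by move=> s s' []. Qed.

Lemma mem_map_cons (b c : bool) (p : treepath) (s : seq treepath) :
  (b :: p \in map (cons c) s) = (b == c) && (p \in s).
Proof.
case: eqP => [->|h] /=; first by rewrite mem_map //; apply: cons_inj.
by apply/mapP => -[q _ [bc _]].
Qed.

(** Compatibility at one node, in the form of [compatible]. *)
Definition local_ok (w : nat -> nat) (t : bintree) (o : nat)
    (K : treepath -> nat) (p : treepath) :=
  [&& (K p < w (o + index (p ++ leftmost (subtree t p)) (leaves t)))%N,
      (rcons p false \in internals t) ==> (K p <= K (rcons p false))%N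
    & (rcons p true \in internals t) ==> (K p < K (rcons p true))%N].

Lemma root_internal t : ([::] \in internals t) = (t != Leaf).
Proof. by case: t. Qed.

Lemma index_leftmost t : index (leftmost t) (leaves t) = 0%N.
Proof.
elim: t => //= l hl r _; rewrite index_cat mem_map; last exact: cons_inj.
rewrite -index_mem hl size_leaves nleaves_gt0 index_map //; exact: cons_inj.
Qed.

Lemma tree_okE w t o m K :
  tree_ok w t o m K =
  ((t == Leaf) || (m <= K [::])%N) && all (local_ok w t o K) (internals t).
Proof.
elim: t o m K => //= l hl r hr o m K.
rewrite all_cat !all_map {}hl {}hr.
have -> : local_ok w (Node l r) o K [::] = [&& (K [::] < w o)%N,
    (l == Leaf) || (K [::] <= K [:: false])%N & (r == Leaf) || (K [::] < K [:: true])%N].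
  rewrite /local_ok /= !inE !mem_cat !mem_map_cons /= !root_internal orbF !implyNb.
  congr [&& (_ < w _)%N, _ & _].
  rewrite index_cat mem_map; last exact: cons_inj.
  rewrite -index_mem index_leftmost size_leaves nleaves_gt0.
  by rewrite index_map ?index_leftmost ?addn0 //; apply: cons_inj.
have -> : all (preim (cons false) (local_ok w (Node l r) o K)) (internals l) =
    all (local_ok w l o (K \o cons false)) (internals l).
  apply: eq_in_all => p hp; rewrite /local_ok /= !inE !mem_cat !mem_map_cons /= !orbF.
  congr [&& (_ < w (_ + _))%N, _ & _].
  rewrite index_cat mem_map; last exact: cons_inj.
  by rewrite mem_leaves_leftmost // index_map //; apply: cons_inj.
have -> : all (preim (cons true) (local_ok w (Node l r) o K)) (internals r) =
    all (local_ok w r (o + nleaves l) (K \o cons true)) (internals r).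
  apply: eq_in_all => p hp; rewrite /local_ok /= !inE !mem_cat !mem_map_cons /=.
  congr [&& (_ < w _)%N, _ & _].
  rewrite index_cat ifF; last by apply/mapP => -[].
  by rewrite index_map ?size_map ?size_leaves ?addnA //; apply: cons_inj.
rewrite -!andbA; do 3 congr (_ && _).
by rewrite andbCA.
Qed.

Fixpoint trees_ok (w : nat -> nat) (ts : seq bintree) (o : nat)
    (K : nat -> treepath -> nat) : bool :=
  if ts is t :: ts' then
    tree_ok w t o 0 (K 0) && trees_ok w ts' (o + nleaves t) (fun j => K j.+1)
  else true.

Fixpoint label_seq (ts : seq bintree) (K : nat -> treepath -> nat) : seq nat :=
  if ts is t :: ts' then map (K 0) (internals t) ++ label_seq ts' (fun j => K j.+1)
  else [::].

Lemma trees_labels_uniq w ts o : uniq (trees_labels w ts o).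
Proof.
elim: ts o => //= t ts IH o; apply: allpairs_uniq => //; first exact: tree_labels_uniq.
move=> -[a b] [a' b'] /allpairsP[[c d] /= [hc hd [-> ->]]].
case/allpairsP=> -[c' d'] /= [hc' hd' [-> ->]] /eqP.
rewrite eqseq_cat; last by rewrite (size_tree_labels hc) (size_tree_labels hc').
by case/andP => /eqP -> /eqP ->.
Qed.

Lemma trees_labelsP w ts o s :
  s \in trees_labels w ts o <-> exists2 K, trees_ok w ts o K & s = label_seq ts K.
Proof.
elim: ts o s => [|t ts IH] o s /=.
  by rewrite inE; split=> [/eqP ->|[_ _ ->]] //; exists (fun _ _ => 0%N).
split.
  case/allpairsP => -[a b] /= [/tree_labelsP[Ka oka ->] /IH[Kb okb ->] ->].
  by exists (fun j => if j is j'.+1 then Kb j' else Ka) => //=; rewrite oka.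
case=> K /andP[okt okf] ->; apply/allpairsP.
exists (map (K 0) (internals t), label_seq ts (fun j => K j.+1)); split=> //=.
  by apply/tree_labelsP; exists (K 0).
by apply/IH; exists (fun j => K j.+1).
Qed.

Lemma trees_okP w ts o K :
  reflect (forall j, (j < size ts)%N ->
     {in internals (nth Leaf ts j), forall p,
        local_ok w (nth Leaf ts j) (o + \sum_(i < j) nleaves (nth Leaf ts i)) (K j) p})
   (trees_ok w ts o K).
Proof.
elim: ts o K => [|t ts IH] o K /=; first by apply: ReflectT.
rewrite tree_okE orbT /=; apply: (iffP andP) => [[/allP h1 /IH h2] [|j] /= hj|h].
- by rewrite big_ord0 addn0.
- by rewrite big_ord_recl /= addnA; apply: h2.
- split; first by apply/allP; have := h 0%N isT; rewrite big_ord0 addn0.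
  apply/IH => j hj; have := h j.+1 hj.
  by rewrite big_ord_recl /= addnA.
Qed.

Definition node_seq (ts : seq bintree) : seq node :=
  [seq (j, p) | j <- iota 0 (size ts), p <- internals (nth Leaf ts j)].

Lemma label_seqE ts K : label_seq ts K = [seq K v.1 v.2 | v <- node_seq ts].
Proof.
rewrite /node_seq map_flatten -map_comp.
rewrite (eq_map (g := fun j => map (K j) (internals (nth Leaf ts j)))); last first.
  by move=> j /=; rewrite -map_comp.
elim: ts K => //= t ts IH K; congr (_ ++ _).
by rewrite IH (iotaDl 1 0) -map_comp.
Qed.

Lemma internals_uniq t : uniq (internals t).
Proof.
elim: t => //= l hl r hr; rewrite cat_uniq !map_inj_uniq ?hl ?hr; try exact: cons_inj.
rewrite mem_cat /= andbT; apply/andP; split; last first.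
  by apply/hasPn => p /mapP[q _ ->]; rewrite mem_map_cons.
by rewrite negb_or; apply/andP; split; apply/mapP => -[].
Qed.

Lemma node_seq_uniq ts : uniq (node_seq ts).
Proof.
apply: allpairs_uniq_dep => [|j _|]; first exact: iota_uniq.
  exact: internals_uniq.
by move=> [j p] [j' p'] _ _ /= [-> ->].
Qed.

Section GenFun.

Variables (A : comNzRingType) (X : nat -> A).

Lemma tree_poly_lab w t o m :
  tree_poly X w t o m = \sum_(s <- tree_labels w t o m) \prod_(k <- s) X k.
Proof.
elim: t o m => [|l hl r hr] o m /=; first by rewrite big_seq1 big_nil.
rewrite big_flatten big_map /=; apply: eq_bigr => k _.
rewrite big_allpairs_dep /= hl hr big_distrlr /= big_distrr /=.
apply: eq_bigr => a _; rewrite big_distrr /=; apply: eq_bigr => b _.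
by rewrite big_cons big_cat.
Qed.

Lemma trees_poly_lab w ts o :
  trees_poly X w ts o = \sum_(s <- trees_labels w ts o) \prod_(k <- s) X k.
Proof.
elim: ts o => [|t ts IH] o /=; first by rewrite big_seq1 big_nil.
rewrite big_allpairs_dep /= tree_poly_lab IH big_distrlr /=.
by apply: eq_bigr => a _; apply: eq_bigr => b _; rewrite big_cat.
Qed.

End GenFun.

(** * Labellings of indexed forests *)

Lemma mem_IN (F : forest) (v : node) : (v \in IN F) = (v.2 \in internals (F v.1)).
Proof.
apply/imfset2P/idP => [[j _ [p hp ->]] //|hv].
exists v.1; last by exists v.2 => //; case: v hv.
suff : v.1 \in finsupp F by [].
by rewrite mem_finsupp; apply: contraTneq hv => ->.
Qed.

Definition extend0 (F : forest) (kappa : IN F -> nat) (v : node) : nat :=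
  if insub v is Some u then kappa u else 0%N.

Lemma extend0_val (F : forest) (kappa : IN F -> nat) (u : IN F) :
  extend0 kappa (val u) = kappa u.
Proof. by rewrite /extend0 valK. Qed.

Section Truncation.

Variables (F : forest) (N : nat).
Hypothesis FN : forall j, (N <= j)%N -> F j = Leaf.

Lemma mem_node_seq (v : node) : (v \in node_seq (mkseq F N)) = (v \in IN F).
Proof.
rewrite mem_IN; apply/allpairsPdep/idP => [[j [p [/=]]]|hv].
  rewrite size_mkseq mem_iota => /andP[_ jN] hp ->.
  by move: hp; rewrite nth_mkseq.
have jN : (v.1 < N)%N by rewrite ltnNge; apply: contraTN hv => /FN ->.
exists v.1, v.2; rewrite size_mkseq mem_iota nth_mkseq //.
by split=> //; case: (v).
Qed.

Lemma compatible_trees_ok (kappa : IN F -> nat) :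
  compatible kappa = trees_ok S (mkseq F N) 0 (fun j p => extend0 kappa (j, p)).
Proof.
have offE j : (j <= N)%N ->
    \sum_(i < j) nleaves (nth Leaf (mkseq F N) i) = \sum_(i < j) size (leaves (F i)).
  move=> jN; apply: eq_bigr => i _; rewrite nth_mkseq ?size_leaves //.
  exact: leq_trans (ltn_ord i) jN.
apply/forallP/trees_okP => [h j|h v].
  rewrite size_mkseq => jN p; rewrite nth_mkseq // => hp.
  have hv : (j, p) \in IN F by rewrite mem_IN.
  have := h [` hv]%fset => /and3P[h1 /forallP h2 /forallP h3].
  have extE q (hq : (j, q) \in IN F) : extend0 kappa (j, q) = kappa [` hq]%fset.
    by rewrite -(extend0_val kappa [` hq]%fset).
  rewrite /local_ok (extE p hv); apply/and3P; split.
  - by rewrite ltnS offE ?add0n //; apply: ltnW.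
  - apply/implyP => hc.
    have hc' : (j, rcons p false) \in IN F by rewrite mem_IN.
    by rewrite (extE _ hc'); apply: (implyP (h2 [` hc']%fset)).
  - apply/implyP => hc.
    have hc' : (j, rcons p true) \in IN F by rewrite mem_IN.
    by rewrite (extE _ hc'); apply: (implyP (h3 [` hc']%fset)).
have hv : val v \in IN F by apply: valP.
have jN : ((val v).1 < N)%N.
  by rewrite ltnNge; apply/negP => /FN hF; move: hv; rewrite mem_IN hF.
have := h (val v).1; rewrite size_mkseq nth_mkseq // => /(_ jN (val v).2).
rewrite -mem_IN hv => /(_ isT); rewrite /local_ok -surjective_pairing extend0_val.
case/and3P=> h1 h2 h3; apply/and3P; split.
- by move: h1; rewrite ltnS offE ?add0n //; apply: ltnW.
- apply/forallP => w; apply/implyP => /eqP wE.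
  have hc : rcons (val v).2 false \in internals (F (val v).1).
    by have := valP w; rewrite mem_IN wE.
  by have := implyP h2 hc; rewrite -[(_, rcons _ _)]/(lchild (val v)) -wE extend0_val.
- apply/forallP => w; apply/implyP => /eqP wE.
  have hc : rcons (val v).2 true \in internals (F (val v).1).
    by have := valP w; rewrite mem_IN wE.
  by have := implyP h3 hc; rewrite -[(_, rcons _ _)]/(rchild (val v)) -wE extend0_val.
Qed.

Variables (A : comNzRingType) (X : nat -> A).

(** The sum runs over functions on [IN F] with a truncated codomain.  Listing the
    values along [node_seq] is a bijection from the compatible functions to
    [trees_labels]; it is onto because compatible labels are bounded by
    [rho_max F]. *)
Lemma forest_sum_trees_poly :
  \sum_(kappa : {ffun IN F -> 'I_(rho_max F).+1} |
         compatible (F := F) (fun v => nat_of_ord (kappa v)))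
    \prod_(v : IN F) X (kappa v) = trees_poly X S (mkseq F N) 0.
Proof.
pose K (kappa : {ffun IN F -> 'I_(rho_max F).+1}) j p :=
  extend0 (fun v => nat_of_ord (kappa v)) (j, p).
rewrite trees_poly_lab.
transitivity (\sum_(s <- [seq label_seq (mkseq F N) (K kappa) |
    kappa <- enum [pred kappa : {ffun IN F -> 'I_(rho_max F).+1} |
       compatible (F := F) (fun v => nat_of_ord (kappa v))]]) \prod_(k <- s) X k).
  rewrite big_map big_enum /=; apply: eq_bigr => kappa _.
  rewrite label_seqE big_map.
  transitivity (\prod_(v : IN F) X (extend0 (fun v => nat_of_ord (kappa v)) (val v))).
    by apply: eq_bigr => v _; rewrite extend0_val.
  rewrite -(big_seq_fsetE _ _ predT
              (fun v => X (extend0 (fun v => nat_of_ord (kappa v)) v))) /=.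
  rewrite (perm_big (node_seq (mkseq F N))) /=.
    by apply: eq_bigr => -[j p] _.
  by apply: uniq_perm; rewrite ?fset_uniq ?node_seq_uniq // => v; rewrite mem_node_seq.
apply: perm_big; apply: uniq_perm; last 1 first.
- move=> s; apply/mapP/idP => [[kappa hk ->]|/trees_labelsP[K' okK' ->]].
    apply/trees_labelsP; exists (K kappa) => //; move: hk; rewrite mem_enum inE => hk.
    by rewrite -compatible_trees_ok.
  pose kappa0 (v : IN F) := K' (val v).1 (val v).2.
  have label_seq_eq (kap : IN F -> nat) : kap =1 kappa0 ->
      label_seq (mkseq F N) (fun j p => extend0 kap (j, p)) = label_seq (mkseq F N) K'.
    move=> e; rewrite !label_seqE; apply/eq_in_map => v; rewrite mem_node_seq => hv.
    by rewrite -surjective_pairing -[v]/(val [` hv]%fset) extend0_val e.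
  have ok0 : compatible kappa0.
    rewrite compatible_trees_ok; apply/trees_okP => j jN p hp.
    have jN' : (j < N)%N by move: jN; rewrite size_mkseq.
    have hp' : p \in internals (F j) by move: hp; rewrite nth_mkseq.
    have e q : q \in internals (F j) -> extend0 kappa0 (j, q) = K' j q.
      move=> hq; have hv : (j, q) \in IN F by rewrite mem_IN.
      by rewrite -[(j, q)]/(val [` hv]%fset) extend0_val.
    have := trees_okP _ _ _ _ okK' j jN p hp; rewrite /local_ok nth_mkseq // e //.
    case/and3P=> -> h2 h3 /=; apply/andP; split; apply/implyP => hc.
      by rewrite e //; apply: (implyP h2).
    by rewrite e //; apply: (implyP h3).
  have le_max v : (kappa0 v < (rho_max F).+1)%N.
    rewrite ltnS; apply: leq_trans (leq_bigmax v).
    by have /forallP/(_ v)/and3P[] := ok0.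
  pose kappa := [ffun v => Ordinal (le_max v)].
  have kE : (fun v => nat_of_ord (kappa v)) =1 kappa0 by move=> v; rewrite ffunE.
  exists kappa; last by rewrite /K label_seq_eq.
  rewrite mem_enum inE; move: ok0; rewrite /compatible => /forallP h; apply/forallP => v.
  rewrite !kE; have /and3P[h1 /forallP h2 /forallP h3] := h v.
  by apply/and3P; split=> //; apply/forallP => u; rewrite kE.
- rewrite map_inj_in_uniq ?enum_uniq // => kap kap' _ _.
  rewrite !label_seqE => /eq_in_map e; apply/ffunP => v; apply: val_inj.
  have := e (val v); rewrite mem_node_seq => /(_ (valP v)).
  by rewrite /K -surjective_pairing !extend0_val.
- exact: trees_labels_uniq.
Qed.

End Truncation.

(** * The polynomial ring in countably many variables *)

Lemma pol_ind (P : Pol -> Prop) :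
    (forall c, P c%:MP) -> (forall i, P (x i)) ->
    (forall f g, P f -> P g -> P (f + g)) ->
    (forall f g, P f -> P g -> P (f * g)) -> forall f, P f.
Proof.
move=> PC PX PD PM f; rewrite (monalgE f).
elim/big_ind: _ => [|//|m _]; first by rewrite -malgC0E.
have -> : << f@_m *g m >> = (f@_m)%:MP * << m >> :> Pol.
  by rewrite malgM_def fgmulUU mulr1 mul1m.
apply: (PM) => //; move: {-1}(mdeg m) (erefl (mdeg m)) => d.
elim: d m => [|d IH] m.
  by move/mdeg_eq0I => ->.
move=> dm; case: (fset_0Vmem (finsupp m)) => [m0|[i im]].
  by move: dm; rewrite mdegE m0 big_seq_fset0.
have mE : m = mmul (ucm i) (divcm m (ucm i)).
  apply/eqP/cmP => j; rewrite cmM cmU divcmE ucmE.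
  case: eqP => [<-|_]; last by rewrite subn0.
  by rewrite subnKC // lt0n cmE_neq0.
have -> : << m >> = x i * << divcm m (ucm i) >> :> Pol.
  by rewrite malgM_def fgmulUU mulr1 -mE.
apply: (PM) => //; apply: IH.
by move: dm; rewrite {1}mE mdegM mdegU => -[].
Qed.

(** The coefficient of a monomial [m] in [g] is that of [x_i m] in [x_i g]. *)
Lemma mulX_inj i : injective ( *%R (x i)).
Proof.
move=> f g; rewrite -[X in X = _]subr0 => /eqP; rewrite subr0 -subr_eq0 -mulrBr => /eqP h.
apply/eqP; rewrite -subr_eq0; apply/eqP.
move: (f - g) h => {f g} g h; apply/malgP => m; rewrite mcoeff0.
move/malgP: h => /(_ (mmul (ucm i) m)); rewrite mcoeff0 malgM_def fgmulUg.
rewrite raddf_sum /= => h; rewrite -[RHS]h.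
have inj n : (mmul (ucm i) n == mmul (ucm i) m) = (n == m).
  apply/eqP/eqP => [e|-> //]; apply/eqP/cmP => j.
  move/eqP/cmP: e => /(_ j); rewrite !cmM; exact: addnI.
under eq_bigr do rewrite mcoeffU inj mul1r.
by rewrite [in LHS](monalgE g) raddf_sum /=; apply: eq_bigr => k _; rewrite mcoeffU.
Qed.

Definition monom_sub (S : comNzRingType) (g : nat -> S) (m : {cmonom nat}) : S :=
  \prod_(i <- finsupp m) g i ^+ m i.

Lemma monom_subE (S : comNzRingType) (g : nat -> S) (m : {cmonom nat})
  (d : {fset nat}) : (finsupp m `<=` d)%fset ->
  monom_sub g m = \prod_(i <- d) g i ^+ m i.
Proof.
move=> le; rewrite /monom_sub (big_fset_incl _ le) //.
by move=> i _; rewrite -cmE_neq0 negbK => /eqP ->; rewrite expr0.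
Qed.

Fact monom_sub_multiplicative (S : comNzRingType) (g : nat -> S) :
  mmorphism (monom_sub g : {cmonom nat} -> S).
Proof.
split=> [m1 m2|]; last by rewrite /monom_sub mdom1 big_seq_fset0.
rewrite /= {1}/monom_sub mdomD (monom_subE g (fsubsetUl _ (finsupp m2))).
rewrite (monom_subE g (fsubsetUr (finsupp m1) _)) -big_split /=.
by apply: eq_bigr => i _; rewrite cmM exprD.
Qed.

HB.instance Definition _ (S : comNzRingType) (g : nat -> S) :=
  isMultiplicative.Build {cmonom nat} S (monom_sub g) (monom_sub_multiplicative g).

Definition subst_pol (g : nat -> Pol) : {rmorphism Pol -> Pol} :=
  mmap (intmul 1 : int -> Pol) (monom_sub g).

Lemma subst_polX g i : subst_pol g (x i) = g i.
Proof.
rewrite /subst_pol /= mmapU /= mul1r /monom_sub mdomU big_seq_fset1.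
by rewrite cmUU expr1.
Qed.

(** * The product formula *)

Lemma trees_poly_uforest (A : comNzRingType) (X : nat -> A) w i o :
  trees_poly X w (nseq i Leaf ++ [:: Node Leaf Leaf]) o = \sum_(k < w (o + i)%N) X k.
Proof.
elim: i o => [|i IH] o /=; last by rewrite mul1r IH addn1 addnS addSn.
rewrite mulr1 addn0 big_mkord; apply: eq_bigr => k _; by rewrite !mulr1.
Qed.

Lemma malgC_int (c : int) : c%:MP = c%:~R :> Pol.
Proof. by rewrite -[c in LHS]intz raddfMz. Qed.

Lemma pol_gen (P : Pol -> Prop) :
    (forall c : int, P c%:~R) -> (forall i, P (x i)) ->
    (forall f g, P f -> P g -> P (f + g)) ->
    (forall f g, P f -> P g -> P (f * g)) -> forall f, P f.
Proof. by move=> PC; apply: pol_ind => c; rewrite malgC_int. Qed.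

Definition R (k : nat) : {rmorphism Pol -> Pol} :=
  subst_pol (fun j => if j == k then 0 else x (squeeze k j)).

Lemma RX k j : R k (x j) = if j == k then 0 else x (squeeze k j).
Proof. exact: subst_polX. Qed.

Definition ev : {rmorphism Pol -> int} := mcoeff (mone : {cmonom nat}).

Lemma evX i : ev (x i) = 0.
Proof. by rewrite /ev /= mcoeffU1 cm1_eq1. Qed.

Definition forest_of (ts : seq bintree) : forest :=
  [fsfun j in seq_fset tt (iota 0 (size ts)) => nth Leaf ts j | Leaf].

Lemma forest_ofE ts j : forest_of ts j = nth Leaf ts j.
Proof.
rewrite fsfunE seq_fsetE mem_iota /= add0n; case: ltnP => // h.
by rewrite nth_default.
Qed.

Lemma forest_poly_of ts : forest_poly (forest_of ts) = standard_poly x ts.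
Proof.
have h j : (size ts <= j)%N -> forest_of ts j = Leaf.
  by move=> hj; rewrite forest_ofE nth_default.
rewrite /standard_poly -[in RHS](_ : mkseq (forest_of ts) (size ts) = ts).
  exact: (forest_sum_trees_poly h).
apply: (@eq_from_nth _ Leaf); rewrite size_mkseq // => j hj.
by rewrite nth_mkseq // forest_ofE.
Qed.

Lemma forest_ofP F : exists ts, F = forest_of ts.
Proof.
exists (mkseq F (\max_(j <- finsupp F) j).+1); apply/fsfunP => j; rewrite forest_ofE.
case: (ltnP j (\max_(j <- finsupp F) j).+1) => h; first by rewrite nth_mkseq.
rewrite nth_default ?size_mkseq // fsfun_dflt //; apply/negP => hj.
by move: h; rewrite ltnNge (big_rem j) //= leq_maxl.
Qed.

Lemma forest_of_inj N : {in [pred ts | size ts == N] &, injective forest_of}.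
Proof.
move=> ts us /eqP tN /eqP uN /fsfunP e; apply: (@eq_from_nth _ Leaf) => [|j _].
  by rewrite tN uN.
by have := e j; rewrite !forest_ofE.
Qed.

Lemma sum_forest_positive N (s : seq (seq bintree)) : uniq s ->
  (forall us, us \in s -> size us = N) ->
  multiplicity_free_forest_positive (\sum_(us <- s) standard_poly x us).
Proof.
move=> us_ sN.
pose a : {fsfun forest -> int with 0} :=
  [fsfun G in seq_fset tt (map forest_of s) => 1 | 0].
have aE G : a G = if G \in map forest_of s then 1 else 0.
  by rewrite fsfunE seq_fsetE.
exists a; last by move=> G; rewrite aE; case: ifP; [right | left].
have um : uniq (map forest_of s).
  rewrite map_inj_in_uniq // => t u ht hu; apply: (@forest_of_inj N);
    by rewrite inE sN.
rewrite /forest_expansion (perm_big (map forest_of s)) /=; last first.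
  apply: uniq_perm; rewrite ?fset_uniq // => G.
  by rewrite mem_finsupp aE; case: (G \in _).
rewrite big_map big_seq [RHS]big_seq; apply: eq_bigr => u hu.
by rewrite aE map_f // scale1r forest_poly_of.
Qed.

Lemma forest_poly_uforest i : forest_poly (uforest i) = varsum x i.+1.
Proof.
have uE j : uforest i j = if j == i then Node Leaf Leaf else Leaf.
  by rewrite fsfunE inE.
have h j : (i < j)%N -> uforest i j = Leaf by move=> ij; rewrite uE gtn_eqF.
rewrite -[varsum x i.+1]/(\sum_(k < S (0 + i)%N) x k) -trees_poly_uforest.
rewrite -[nseq i Leaf ++ _](_ : mkseq (uforest i) i.+1 = _).
  exact: (forest_sum_trees_poly h).
apply: (@eq_from_nth _ Leaf); rewrite size_mkseq ?size_cat ?size_nseq ?addn1 // => j ji.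
rewrite nth_mkseq // uE nth_cat size_nseq nth_nseq.
by case: (ltngtP j i) ji => [hj|hj|->] //; rewrite ?subnn // ltnS leqNgt hj.
Qed.

Theorem theorem7p4 (F : forest) (i : nat) :
  forest_poly (uforest i) * forest_poly F
    = (\sum_(j < i.+1) x j) * forest_poly F
  /\ multiplicity_free_forest_positive
       (forest_poly (uforest i) * forest_poly F).
Proof.
rewrite forest_poly_uforest; split=> [//|]; have [ts ->] := forest_ofP F.
rewrite forest_poly_of.
have [N [s us [sN ->]]] :=
  varsum_standard_poly_expansion pol_gen (@mulX_inj) RX evX i.+1 ts.
exact: sum_forest_positive us sN.
Qed.
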